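(* The data $(P,\eta,(\gg\!=))$ (the construction $P$ of quasi-Borel spaces of probability measures, with its unit $\eta$ and bind operation, all defined in the context) defines a strong monad on the category $\mathbf{QBS}$ of quasi-Borel spaces.
   Context: A quasi-Borel space is a set $X$ together with a set $M_X$ of functions $\mathbb{R}\to X$ such that: (i) $\alpha\circ f\in M_X$ whenever $\alpha\in M_X$ and $f\colon\mathbb{R}\to\mathbb{R}$ is (Borel) measurable; (ii) every constant function $\mathbb{R}\to X$ is in $M_X$; (iii) if $\mathbb{R}=\biguplus_{i\in\mathbb{N}}S_i$ with each $S_i$ Borel and $\alpha_i\in M_X$ for each $i$, then $\beta\in M_X$, where $\beta(r)=\alpha_i(r)$ for $r\in S_i$. A morphism $(X,M_X)\to(Y,M_Y)$ is a function $f\colon X\to Y$ with $f\circ\alpha\in M_Y$ for all $\alpha\in M_X$; these form the category $\mathbf{QBS}$, which is cartesian closed: products are product sets with $M_{X\times Y}=\{f\mid \pi_1\circ f\in M_X,\ \pi_2\circ f\in M_Y\}$, and the function space $Y^X$ is the set of morphisms $X\to Y$ with $M_{Y^X}=\{\alpha\colon\mathbb{R}\to Y^X\mid (r,x)\mapsto\alpha(r)(x)\text{ is a morphism }\mathbb{R}\times X\to Y\}$, where $M_{\mathbb{R}}$ is the set of measurable functions $\mathbb{R}\to\mathbb{R}$. For a quasi-Borel space, $\Sigma_{M_X}=\{U\subseteq X\mid\forall\alpha\in M_X.\ \alpha^{-1}(U)\text{ is Borel}\}$, a $\sigma$-algebra on $X$. For a measurable space $Z$, $G(Z)$ is the set of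 probability measures on $Z$ with the $\sigma$-algebra generated by the sets $\{\mu\mid\mu(U)<r\}$ for $U$ measurable and $r\in[0,1]$; $G$ is the Giry monad, with bind $(\mu\gg\!=_G k)(U)=\int k(x)(U)\,\mathrm{d}\mu(x)$ for measurable $k\colon Z\to G(Z')$. A probability measure on $(X,M_X)$ is a pair $(\alpha,\mu)$ with $\alpha\in M_X$ and $\mu$ a Borel probability measure on $\mathbb{R}$. Write $(\alpha,\mu)\sim(\alpha',\mu')$ if the push-forward measures $\alpha_*\mu$ and $\alpha'_*\mu'$ on $(X,\Sigma_{M_X})$ are equal, and $[\alpha,\mu]$ for the equivalence class. Objects: $P(X)$ is the set of probability measures on $(X,M_X)$ modulo $\sim$, and $M_{P(X)}$ is the set of $\beta\colon\mathbb{R}\to P(X)$ for which there exist $\alpha\in M_X$ and a measurable $g\colon\mathbb{R}\to G(\mathbb{R})$ with $\beta(r)=[\alpha,g(r)]$ for all $r\in\mathbb{R}$. Unit: $\eta_X(x)=[\lambda r.\,x,\ \mu]$ for an arbitrary probability measure $\mu$ on $\mathbb{R}$ (the class does not depend on $\mu$). Bind: for a morphism $f\colon X\to P(Y)$ and $[\alpha,\mu]\in P(X)$, pick a measurable $g\colon\mathbb{R}\to G(\mathbb{R})$ and $\beta\in M_Y$ with $(f\circ\alpha)(r)=[\beta,g(r)]$ for all $r$ (these exist since $f\circ\alpha\in M_{P(Y)}$), and set $([\alpha,\mu]\gg\!= f)=[\beta,\ \mu\gg\!=_G g]$. A strong monad (Kleisli triple formulation) on a cartesian closed category consists of objects $T(X)$,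 morphisms $\eta\colon X\to T(X)$, and morphisms $(\gg\!=)\colon T(Y)^X\to T(Y)^{T(X)}$ satisfying $(t\gg\!=\eta)=t$, $(\eta(x)\gg\!= f)=f(x)$ and $t\gg\!=(\lambda x.\,(f(x)\gg\!= g))=(t\gg\!= f)\gg\!= g$. *)

(* Defs.v *)
From HB Require Import structures.
From mathcomp Require Import all_boot all_order all_algebra.
From mathcomp Require Import all_classical all_reals all_analysis.
From mathcomp Require Import measurable_realfun.

Set Implicit Arguments.
Unset Strict Implicit.
Unset Printing Implicit Defensive.

Import Order.TTheory GRing.Theory Num.Theory.
Import numFieldNormedType.Exports.

Local Open Scope classical_set_scope.
Local Open Scope ring_scope.

Section giry_bind.
Local Open Scope ereal_scope.
Context d d' (T : measurableType d) (T' : measurableType d') (R : realType).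
Variables (mu : probability T R) (k : {mfun T >-> pprobability T' R}).

(* Bind of the Giry monad; pprobability T' R carries the sigma-algebra generated
   by the sets of probability measures nu such that nu U < r. *)
Definition prob_bind (U : set T') : \bar R := \int[mu]_x k x U.

Let measurable_ev U : measurable U ->
  measurable_fun [set: T] (fun x => k x U).
Proof.
by move=> mU; exact: (measurable_kernel (kprobability (@measurable_funPT _ _ _ _ k))).
Qed.

Let prob_bind0 : prob_bind set0 = 0.
Proof.
by rewrite /prob_bind (eq_integral (cst 0)) ?integral0// => x _; rewrite measure0.
Qed.

Let prob_bind_ge0 U : 0 <= prob_bind U.
Proof. exact: integral_ge0. Qed.

Let prob_bind_sigma_additive : semi_sigma_additive prob_bind.
Proof.
move=> F mF tF mUF; rewrite [X in _ --> X](_ : _ =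
    \int[mu]_x \sum_(0 <= n <oo) k x (F n)); last first.
  apply: eq_integral => x _.
  by apply/esym/cvg_lim => //; exact/measure_semi_sigma_additive.
apply/cvg_closeP; split.
  by apply: is_cvg_nneseries => n _ _; exact: integral_ge0.
rewrite closeE// integral_nneseries// => n.
exact: measurable_ev.
Qed.

HB.instance Definition _ := isMeasure.Build _ _ _ prob_bind
  prob_bind0 prob_bind_ge0 prob_bind_sigma_additive.

Let prob_bindT : prob_bind setT = 1.
Proof.
rewrite /prob_bind (eq_integral (cst 1)) => [|x _]; last exact: probability_setT.
by rewrite integral_cst// mul1e; exact: probability_setT.
Qed.

HB.instance Definition _ := Measure_isProbability.Build _ _ _ prob_bind prob_bindT.

End giry_bind.

Section quasi_borel.
Variable R : realType.

(* R plays the real line, with the library's Borel sigma-algebra. *)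
Record quasi_borel (T : Type) (M : set (R -> T)) : Prop := QuasiBorel {
  qb_comp : forall (a : R -> T) (f : R -> R),
    M a -> measurable_fun setT f -> M (a \o f) ;
  qb_cst : forall x : T, M (cst x) ;
  qb_glue : forall (S : (set R)^nat) (a : nat -> R -> T) (b : R -> T),
    (forall i, measurable (S i)) -> trivIset setT S -> \bigcup_i S i = setT ->
    (forall i, M (a i)) -> (forall i r, S i r -> b r = a i r) -> M b }.

Record qbs := Qbs {
  qbs_sort :> Type ;
  plots : set (R -> qbs_sort) ;
  plotsP : quasi_borel plots }.

Arguments plots : clear implicits.
Arguments plotsP : clear implicits.

Definition is_morphism (X Y : qbs) (f : X -> Y) : Prop :=
  forall a, plots X a -> plots Y (f \o a).

Record qhom (X Y : qbs) := Qhom {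
  qhom_fun :> X -> Y ;
  qhomP : is_morphism qhom_fun }.

Lemma qcomp_morphism (X Y Z : qbs) (g : qhom Y Z) (f : qhom X Y) :
  is_morphism (g \o f).
Proof. by move=> a /(qhomP f) /(qhomP g). Qed.

Definition qcomp (X Y Z : qbs) (g : qhom Y Z) (f : qhom X Y) : qhom X Z :=
  Qhom (qcomp_morphism g f).

Lemma quasi_borel_real :
  quasi_borel [set f : R -> R | measurable_fun setT f].
Proof.
split => [a f /= ma mf|x /=|S a b mS _ ST ma ba /=].
- exact: measurableT_comp.
- exact: measurable_cst.
- rewrite -ST; apply/measurable_fun_bigcup => // i.
  apply: (eq_measurable_fun (a i)); last by apply: measurable_funTS; exact: ma.
  by move=> r; rewrite inE => /ba.
Qed.

Definition qreal : qbs := Qbs quasi_borel_real.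

Lemma quasi_borel_prod (X Y : qbs) : quasi_borel
  [set f : R -> X * Y | plots X (fst \o f) /\ plots Y (snd \o f)].
Proof.
split => [a f /= [a1 a2] mf|x /=|S a b mS tS ST /= ma ba].
- by split; [exact: (qb_comp (plotsP X) a1)|exact: (qb_comp (plotsP Y) a2)].
- by split; [exact: (qb_cst (plotsP X))|exact: (qb_cst (plotsP Y))].
- split.
  + apply: (qb_glue (plotsP X) (a := fun i => fst \o a i) mS tS ST).
      by move=> i; have [] := ma i.
    by move=> i r Sir /=; rewrite (ba i).
  + apply: (qb_glue (plotsP Y) (a := fun i => snd \o a i) mS tS ST).
      by move=> i; have [] := ma i.
    by move=> i r Sir /=; rewrite (ba i).
Qed.

Definition qprod (X Y : qbs) : qbs := Qbs (quasi_borel_prod X Y).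

Lemma quasi_borel_exp (X Y : qbs) : quasi_borel
  [set a : R -> qhom X Y |
    is_morphism (fun rx : qprod qreal X => (a rx.1 rx.2 : Y))].
Proof.
split => [a f /= ma mf|h /=|S a b mS tS ST /= ma ba].
- move=> c [/= c1 c2].
  by apply: (ma (fun r => (f (c r).1, (c r).2))); split => //=;
    exact: measurableT_comp.
- by move=> c [/= _ c2]; exact: (qhomP h).
- move=> c [/= c1 c2].
  apply: (qb_glue (plotsP Y) (S := fun i => (fst \o c) @^-1` S i)
      (a := fun i r => a i (c r).1 (c r).2)).
  + by move=> i; rewrite -[X in measurable X]setTI; exact: c1.
  + by apply/trivIsetP => i j _ _ ij; rewrite -preimage_setI;
      move/trivIsetP : tS => /(_ i j I I ij) ->; rewrite preimage_set0.
  + by rewrite -preimage_bigcup ST preimage_setT.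
  + by move=> i; exact: (ma i c).
  + by move=> i r /= Sir; rewrite (ba i).
Qed.

Definition qexp (X Y : qbs) : qbs := Qbs (quasi_borel_exp X Y).

(* The coercion of qhom to functions does not see through qbs_sort. *)
Definition qapp (X Y : qbs) (h : qexp X Y) : X -> Y := qhom_fun h.

Definition qbs_sigma (X : qbs) : set (set X) :=
  [set U | forall a, plots X a -> measurable (a @^-1` U)].
Arguments qbs_sigma : clear implicits.

Record qprob (X : qbs) := Qprob {
  qprob_plot : R -> X ;
  qprob_plotP : plots X qprob_plot ;
  qprob_meas : probability R R }.

HB.instance Definition _ (X : qbs) := gen_eqMixin (qprob X).
HB.instance Definition _ (X : qbs) := gen_choiceMixin (qprob X).

(* Equality of the push-forwards of p and q on (X, qbs_sigma X). Quantifying over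
   qbs_sigma only is essential: a probability is a function on all sets. *)
Definition qprob_equiv (X : qbs) (p q : qprob X) : bool :=
  `[< forall U, qbs_sigma X U ->
        qprob_meas p (qprob_plot p @^-1` U) =
        qprob_meas q (qprob_plot q @^-1` U) >].

Lemma qprob_equiv_refl X : reflexive (@qprob_equiv X).
Proof. by move=> p; apply/asboolP. Qed.

Lemma qprob_equiv_sym X : symmetric (@qprob_equiv X).
Proof.
by move=> p q; apply/asboolP/asboolP => pq U sU; rewrite pq.
Qed.

Lemma qprob_equiv_trans X : transitive (@qprob_equiv X).
Proof.
by move=> q p r /asboolP pq /asboolP qr; apply/asboolP => U sU; rewrite pq// qr.
Qed.

Canonical qprob_equiv_rel X := EquivRel (@qprob_equiv X)
  (@qprob_equiv_refl X) (@qprob_equiv_sym X) (@qprob_equiv_trans X).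

Local Open Scope quotient_scope.

Definition qP (X : qbs) : Type := {eq_quot (qprob_equiv_rel X)}.

Definition qclass (X : qbs) (a : R -> X) (pa : plots X a)
    (mu : probability R R) : qP X :=
  \pi_({eq_quot (qprob_equiv_rel X)}) (Qprob pa mu).

Lemma qclassP (X : qbs) (a b : R -> X) (pa : plots X a) (pb : plots X b)
    (mu nu : probability R R) :
  qclass pa mu = qclass pb nu <->
  forall U, qbs_sigma X U -> mu (a @^-1` U) = nu (b @^-1` U).
Proof.
split; first by move=> /eqmodP /asboolP.
by move=> h; apply/eqmodP/asboolP.
Qed.

Definition qP_plots (X : qbs) : set (R -> qP X) :=
  [set b | exists (a : R -> X) (pa : plots X a) (g : {mfun R >-> pprobability R R}),
    forall r, b r = qclass pa (g r)].

(* Kleisli-triple presentation; the bind is a morphism of function spaces,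
   which is what makes the monad strong. *)
Record is_strong_monad (T : qbs -> qbs) (eta : forall X, qhom X (T X))
    (bind : forall X Y, qhom (qexp X (T Y)) (qexp (T X) (T Y))) : Prop := {
  bind_unitr : forall (X : qbs) (t : T X), qapp (bind X X (eta X)) t = t ;
  bind_unitl : forall (X Y : qbs) (x : X) (f : qhom X (T Y)),
    qapp (bind X Y f) (eta X x) = f x ;
  bind_assoc : forall (X Y Z : qbs) (t : T X) (f : qhom X (T Y)) (g : qhom Y (T Z)),
    qapp (bind X Z (qcomp (bind Y Z g : qhom _ _) f)) t =
    qapp (bind Y Z g) (qapp (bind X Y f) t) }.

End quasi_borel.

Arguments plots {R} q _.
Arguments plotsP {R} q.
Arguments qbs_sigma {R} X _.
Arguments qP_plots {R} X _.

(* Main.v *)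
(* Everything rests on the fact that a class [alpha, mu] is determined by its
   evaluations U |-> mu (alpha^-1 U) on Sigma_X, and on a measurable injection
   e : R * R -> R with a measurable left inverse. For the bind, the integral of
   F o alpha against mu is the integral of the identity against the law of
   F o alpha, which depends on [alpha, mu] only as soon as F o gamma is
   measurable for every plot gamma; hence the bind does not depend on the chosen
   representatives. The injection e is used twice: to merge countably many
   plots alpha_i of X into a single plot alpha (e (i, s)) = alpha_i s, so that
   P X is closed under gluing, and to turn a map (r, s) |-> c r (alpha s) into a
   plot in one real variable, so that the bind is a morphism of function
   spaces. The monad laws then reduce to those of the Giry monad. *)
Require Import Defs.
From HB Require Import structures.
From mathcomp Require Import all_boot all_order all_algebra.
From mathcomp Require Import all_classical all_reals all_analysis.
From mathcomp Require Import measurable_realfun.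
From mathcomp Require Import lra.

Set Implicit Arguments.
Unset Strict Implicit.
Unset Printing Implicit Defensive.

Import Order.TTheory GRing.Theory Num.Theory.
Import numFieldNormedType.Exports.

Local Open Scope classical_set_scope.
Local Open Scope ring_scope.

(** * A measurable injection of the plane into the line, with measurable decoding *)

(* A real number is coded by the sequence of bits telling which rationals lie
   below it, and recovered as a supremum. *)
Section cut_bits.
Variable R : realType.

Definition rat_enum (n : nat) : R := ratr (odflt 0 (unpickle n)).

Definition cut_bits (x : R) (n : nat) : bool := rat_enum n < x.

(** Bits that are off contribute -oo, and [esups] at 0 is the supremum of the whole sequence, in a
    form whose measurability is known. *)
Definition bits_sup (t : nat -> bool) : R :=
  fine (esups (fun n => if t n then (rat_enum n)%:E else -oo%E) 0).

Lemma cut_bitsK x : bits_sup (cut_bits x) = x.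
Proof.
rewrite /bits_sup /esups /=.
suff -> : ereal_sup (sdrop (fun n => if cut_bits x n then (rat_enum n)%:E
    else -oo%E) 0) = x%:E by [].
apply/eqP; rewrite eq_le; apply/andP; split.
  apply: ge_ereal_sup => _ [n _ <-] /=; rewrite /cut_bits.
  by case: ifPn => [nx|_]; [rewrite lee_fin ltW|rewrite leNye].
(* A rational strictly between [x - e] and [x] has its bit set, so it is a term of the supremum. *)
apply/lee_subgt0Pr => e e0.
have /rat_in_itvoo[q] : x - e < x by rewrite ltrBlDr ltrDl.
rewrite in_itv /= => /andP[eq qx].
apply: (@le_trans _ _ (ratr q)%:E); first by rewrite -EFinB lee_fin ltW.
apply: ereal_sup_ubound; exists (pickle q) => //=.
by rewrite /cut_bits /rat_enum pickleK /= qx.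
Qed.

Lemma measurable_cut_bits n : measurable_fun setT (cut_bits ^~ n).
Proof. exact: measurable_fun_ltr. Qed.

Lemma measurable_bits_sup d (T : measurableType d) (t : T -> nat -> bool) :
  (forall n, measurable_fun setT (t ^~ n)) ->
  measurable_fun setT (bits_sup \o t).
Proof.
move=> mt; apply: (measurableT_comp (f := fine)) => //.
apply: (@measurable_fun_esups _ _ _ _
  (fun n x => if t x n then (rat_enum n)%:E else -oo%E)) => n.
exact: measurable_fun_ifT.
Qed.

End cut_bits.

(* Bit sequences are coded as ternary expansions with digits 0 and 1: the values
   lie in [0, 1/2], so that the head of the sequence can be read off by comparing
   3 p with 1. *)
Section ternary.
Variable R : realType.

Definition ternary_term (t : nat -> bool) (n : nat) : \bar R :=
  ((t n)%:R / 3 ^+ n.+1)%:E.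

Definition ternary (t : nat -> bool) : R :=
  fine (\sum_(0 <= n <oo) ternary_term t n)%E.

(** Drops the leading digit of a code; off the codes only measurability matters. *)
Definition ternary_shift (p : R) : R := 3 * p - (1 <= 3 * p)%R%:R.

Definition ternary_bit (n : nat) (p : R) : bool :=
  1 <= 3 * iter n ternary_shift p.

Lemma ternary_term_ge0 t n : (0 <= ternary_term t n)%E.
Proof. by rewrite lee_fin divr_ge0// exprn_ge0. Qed.

Lemma ternary_sum_le t :
  (\sum_(0 <= n <oo) ternary_term t n <= (1 / 2)%:E)%E.
Proof.
apply: lime_le.
  by apply: is_cvg_nneseries => n _ _; exact: ternary_term_ge0.
apply: nearW => n.
(* The exact partial sum of the all-ones expansion is the bound that makes the induction close. *)
suff : \sum_(0 <= k < n) ((t k)%:R / 3 ^+ k.+1) <= (1 - 3 ^- n) / 2 :> R.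
  rewrite /ternary_term sumEFin lee_fin => /le_trans; apply.
  by rewrite ler_pM2r ?invr_gt0// gerBl invr_ge0 exprn_ge0.
elim: n => [|n ih]; first by rewrite big_geq// expr0 invr1 subrr mul0r.
rewrite big_nat_recr//=.
have : (t n)%:R / 3 ^+ n.+1 <= 3 ^- n.+1 :> R.
  by rewrite ler_piMl ?invr_ge0 ?exprn_ge0//; case: (t n).
rewrite !exprSr invfM; move: ih; set u := (3 ^- n); lra.
Qed.

Lemma ternaryE t : (ternary t)%:E = (\sum_(0 <= n <oo) ternary_term t n)%E.
Proof.
rewrite /ternary fineK// ge0_fin_numE.
  by rewrite (le_lt_trans (ternary_sum_le t))// ltry.
by apply: nneseries_ge0 => n _ _; exact: ternary_term_ge0.
Qed.

Lemma ternary_ge0 t : 0 <= ternary t.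
Proof.
rewrite -lee_fin ternaryE.
by apply: nneseries_ge0 => n _ _; exact: ternary_term_ge0.
Qed.

Lemma ternary_le t : ternary t <= 1 / 2.
Proof. by rewrite -lee_fin ternaryE ternary_sum_le. Qed.

Lemma ternary_rec t : 3 * ternary t = (t 0%N)%:R + ternary (t \o S).
Proof.
apply: EFin_inj; rewrite EFinM [in RHS]EFinD !ternaryE.
rewrite nneseries_recl//; last by move=> k _; exact: ternary_term_ge0.
rewrite -(nneseries_addn 1); last by move=> k; exact: ternary_term_ge0.
have -> : (\sum_(0 <= n <oo) ternary_term (t \o S) n =
    3%:E * \sum_(0 <= n <oo) ternary_term t (n + 1))%E.
  rewrite -nneseriesZl; last by move=> k _; exact: ternary_term_ge0.
  apply: eq_eseriesr => n _; rewrite /ternary_term/= addn1 -EFinM.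
  congr EFin; rewrite [3 ^+ n.+2]exprS invfM mulrCA; congr (_ * _).
  by rewrite mulrA mulfV// mul1r.
rewrite ge0_muleDr; last 2 first.
- exact: ternary_term_ge0.
- by apply: nneseries_ge0 => n _ _; exact: ternary_term_ge0.
congr (_ + _)%E; rewrite /ternary_term -EFinM; congr EFin.
by rewrite expr1 mulrCA mulfV// mulr1.
Qed.

(** With head 0 the tail gives at most 1/2; in base 2 an all-ones tail would reach the threshold
    1. *)
Lemma ternary_head t : (1 <= 3 * ternary t) = t 0%N.
Proof.
rewrite ternary_rec.
have := ternary_ge0 (t \o S); have := ternary_le (t \o S).
by case: (t 0%N) => /= h1 h2; [rewrite lerDl|apply/negbTE; rewrite -ltNge; lra].
Qed.

Lemma ternary_shiftE t : ternary_shift (ternary t) = ternary (t \o S).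
Proof. by rewrite /ternary_shift ternary_head ternary_rec addrC addKr. Qed.

Lemma ternary_bitK t n : ternary_bit n (ternary t) = t n.
Proof.
rewrite /ternary_bit; elim: n t => [|n ih] t /=; first exact: ternary_head.
by rewrite -iterS iterSr ternary_shiftE ih.
Qed.

Lemma measurable_ternary_shift : measurable_fun setT ternary_shift.
Proof.
apply: measurable_funB; first exact: measurable_funM.
rewrite (_ : (fun x => _) = (fun x : R => if 1 <= 3 * x then 1 else 0)).
  by apply: measurable_fun_ifT => //; exact: measurable_fun_ler.
by apply/funext => x; case: ifP.
Qed.

Lemma measurable_ternary_bit n : measurable_fun setT (ternary_bit n).
Proof.
apply: measurable_fun_ler => //; apply: measurable_funM => //.
elim: n => [|n ih] /=; first exact: measurable_id.
exact: measurableT_comp measurable_ternary_shift ih.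
Qed.

Lemma measurable_ternary d (T : measurableType d) (t : T -> nat -> bool) :
  (forall n, measurable_fun setT (t ^~ n)) ->
  measurable_fun setT (ternary \o t).
Proof.
move=> mt; apply: (measurableT_comp (f := fine)) => //.
apply: (@ge0_emeasurable_sum _ _ _ setT (fun n x => ternary_term (t x) n) xpredT).
  by move=> k x _ _; exact: ternary_term_ge0.
move=> k _; apply/measurable_EFinP; apply: measurable_funM => //.
rewrite (_ : (fun x => _) = (fun x => if t x k then 1 else 0)).
  exact: measurable_fun_ifT.
by apply/funext => x; case: ifP.
Qed.

End ternary.

(** Bits are interleaved: those of [x] at even positions, those of [y] at odd ones. *)
Lemma real_pairing (R : realType) :
  exists (e : R * R -> R) (d1 d2 : R -> R),
  [/\ measurable_fun setT e, measurable_fun setT d1, measurable_fun setT d2,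
      forall x y, d1 (e (x, y)) = x & forall x y, d2 (e (x, y)) = y].
Proof.
pose t (p : R * R) n :=
  if odd n then cut_bits p.2 n./2 else cut_bits p.1 n./2.
exists (@ternary R \o t).
exists (@bits_sup R \o (fun p n => ternary_bit n.*2 p)).
exists (@bits_sup R \o (fun p n => ternary_bit n.*2.+1 p)).
split.
- apply: measurable_ternary => n; rewrite /t; case: (odd n).
  + exact: measurableT_comp (measurable_cut_bits _) measurable_snd.
  + exact: measurableT_comp (measurable_cut_bits _) measurable_fst.
- by apply: measurable_bits_sup => n; exact: measurable_ternary_bit.
- by apply: measurable_bits_sup => n; exact: measurable_ternary_bit.
- move=> x y /=; rewrite -[RHS]cut_bitsK; congr bits_sup.
  by apply/funext => n; rewrite ternary_bitK /t odd_double doubleK.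
- move=> x y /=; rewrite -[RHS]cut_bitsK; congr bits_sup.
  apply/funext => n.
  by rewrite ternary_bitK /t/= odd_double/= uphalf_double.
Qed.

(** * Kernels as measurable maps into probability measures *)

Section pprobability.
Context d d' (T : measurableType d) (T' : measurableType d') (R : realType).

Lemma measurable_pprobability_ev (g : {mfun T >-> pprobability T' R})
    (U : set T') : measurable U -> measurable_fun setT (fun x => g x U).
Proof.
exact: (measurable_kernel (kprobability (@measurable_funPT _ _ _ _ g))).
Qed.

(** The generating sets are preimages of half-lines under evaluations at measurable sets. *)
Lemma measurable_to_pprobability (k : T -> pprobability T' R) :
  (forall U : set T', measurable U -> measurable_fun setT (fun x => k x U)) ->
  measurable_fun setT k.
Proof.
move=> mk.
apply: (measurability (@pset _ _ _ : set (set (pprobability T' R)))) => //.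
move=> _ -[_ [r r01] [U mU <-]] <-.
by apply: emeasurable_fun_infty_o => //; exact: mk.
Qed.

Definition mfun_of (f : T -> T') (mf : measurable_fun setT f) :
  {mfun T >-> T'} := HB.pack f (isMeasurableFun.Build _ _ _ _ f mf).

End pprobability.

(* [prob_bind mu g] is the parameterized composition of the constant kernel mu,
   with parameter space unit, and g. *)
Lemma integral_prob_bind d1 d2 (T1 : measurableType d1) (T2 : measurableType d2)
    (R : realType) (mu : probability T1 R) (g : {mfun T1 >-> pprobability T2 R})
    (f : T2 -> \bar R) :
  (forall y, 0 <= f y)%E -> measurable_fun setT f ->
  (\int[prob_bind mu g]_y f y = \int[mu]_x \int[g x]_y f y)%E.
Proof.
move=> f0 mf.
have mmu : measurable_fun setT (fun _ : unit => mu : pprobability T1 R).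
  exact: measurable_cst.
have mg : measurable_fun setT (fun p : unit * T1 => g p.2).
  exact: measurableT_comp (@measurable_funPT _ _ _ _ g) measurable_snd.
exact: (integral_kcomp (kprobability mmu) (kprobability mg) tt f0 mf).
Qed.

(** * Countable Borel partitions as index functions *)

Section index.
Variable R : realType.

Lemma partition_index T (S : (set T)^nat) :
  trivIset setT S -> \bigcup_i S i = setT ->
  exists idx : T -> nat, forall i, S i = idx @^-1` [set i].
Proof.
move=> tS ST.
have /choice[idx Sidx] : forall r, exists i, S i r.
  by move=> r; have : [set: T] r by []; rewrite -ST => -[i _]; exists i.
exists idx => i; apply/seteqP; split=> [r Sir|r /= <-]; last exact: Sidx.
by apply: (tS (idx r) i) => //; exists r.
Qed.

Lemma measurable_fun_index d d' (T : measurableType d) (T' : measurableType d')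
    (idx : T -> nat) (f : nat -> T -> T') :
  (forall i, measurable (idx @^-1` [set i])) ->
  (forall i, measurable_fun setT (f i)) ->
  measurable_fun setT (fun r => f (idx r) r).
Proof.
move=> midx mf.
rewrite (_ : setT = \bigcup_i (idx @^-1` [set i])); last first.
  by apply/seteqP; split=> // r _; exists (idx r).
apply/measurable_fun_bigcup => // i.
apply: (eq_measurable_fun (f i)); last exact: measurable_funTS.
by move=> r; rewrite inE => /= ->.
Qed.

Lemma qb_index (T : Type) (M : set (R -> T)) (idx : R -> nat)
    (a : nat -> R -> T) : quasi_borel M ->
  (forall i, measurable (idx @^-1` [set i])) -> (forall i, M (a i)) ->
  M (fun r => a (idx r) r).
Proof.
move=> qM midx Ma.
apply: (qb_glue qM (S := fun i => idx @^-1` [set i]) (a := a)) => //.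
- by move=> i j _ _ [r [/= <- <-]].
- by apply/seteqP; split=> // r _; exists (idx r).
- by move=> i r /= ->.
Qed.

(** Serves to read back a natural number stored as a real coordinate. *)
Lemma measurable_truncn_norm (f : R -> R) i : measurable_fun setT f ->
  measurable ((fun r => Num.trunc `|f r|) @^-1` [set i]).
Proof.
move=> mf.
rewrite (_ : _ @^-1` _ =
    (fun r => (i%:R <= `|f r|) && (`|f r| < i.+1%:R)) @^-1` [set true]).
  rewrite -[X in measurable X]setTI.
  suff m : measurable_fun setT
      (fun r => (i%:R <= `|f r|) && (`|f r| < i.+1%:R)) by exact: m.
  apply: measurable_and.
  - by apply: measurable_fun_ler => //; exact: measurableT_comp.
  - by apply: measurable_fun_ltr => //; exact: measurableT_comp.
by apply/seteqP; split=> r /=; rewrite -truncn_eq// => /eqP.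
Qed.

End index.

(** * Evaluations, integrals and the quasi-Borel structure on classes *)

Section qP_theory.
Variable R : realType.
Implicit Types X Y : qbs R.

Definition qP_ev X (t : qP X) (U : set X) : \bar R :=
  qprob_meas (repr t) (qprob_plot (repr t) @^-1` U).

Definition qP_int X (t : qP X) (F : X -> \bar R) : \bar R :=
  (\int[qprob_meas (repr t)]_r F (qprob_plot (repr t) r))%E.

Lemma qclass_repr X (t : qP X) :
  qclass (qprob_plotP (repr t)) (qprob_meas (repr t)) = t.
Proof. by rewrite -[RHS]reprK /qclass; case: (repr t). Qed.

Lemma qP_evE X (a : R -> X) (pa : plots X a) (mu : probability R R) U :
  qbs_sigma X U -> qP_ev (qclass pa mu) U = mu (a @^-1` U).
Proof. by have /qclassP := qclass_repr (qclass pa mu); apply. Qed.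

Lemma qP_ev_inj X (s t : qP X) :
  (forall U, qbs_sigma X U -> qP_ev s U = qP_ev t U) -> s = t.
Proof.
by move=> st; rewrite -[s]qclass_repr -[t]qclass_repr; apply/qclassP.
Qed.

Lemma qP_ev_ge0 X (t : qP X) U : (0 <= qP_ev t U)%E.
Proof. exact: measure_ge0. Qed.

Lemma measurable_qP_ev X (b : R -> qP X) U :
  qP_plots X b -> qbs_sigma X U ->
  measurable_fun setT (fun r => qP_ev (b r) U).
Proof.
move=> [a [pa [g bE]]] sU.
rewrite (_ : (fun r => _) = (fun r => g r (a @^-1` U))).
  by apply: measurable_pprobability_ev; exact: sU.
by apply/funext => r; rewrite bE qP_evE.
Qed.

Lemma qP_intE X (a : R -> X) (pa : plots X a) (mu : probability R R)
    (F : X -> \bar R) :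
  (forall x, 0 <= F x)%E ->
  (forall b, plots X b -> measurable_fun setT (F \o b)) ->
  qP_int (qclass pa mu) F = (\int[mu]_r F (a r))%E.
Proof.
move=> F0 mF; rewrite /qP_int.
have /qclassP := qclass_repr (qclass pa mu).
move: (repr _) => [b pb nu] /= bE.
(* The absolute value is harmless as F >= 0, and makes the integrand
   nonnegative on the whole of \bar R. *)
have int_image c (pc : plots X c) (m : probability R R) :
    (\int[m]_r F (c r) = \int[distribution m (mfun_of (mF c pc))]_y `|y|)%E.
  rewrite ge0_integral_pushforward//.
  by apply: eq_integral => r _ /=; rewrite gee0_abs.
rewrite (int_image b pb) (int_image a pa).
apply: eq_measure_integral => V mV _.
apply: (bE (F @^-1` V)) => c pc.
rewrite -comp_preimage -[X in measurable X]setTI.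
exact: (mF c pc measurableT V mV).
Qed.

Lemma quasi_borel_qP X : quasi_borel (qP_plots X).
Proof.
have [e [d1 [d2 [me md1 md2 d1K d2K]]]] := real_pairing R.
split.
- move=> b f [a [pa [g bE]]] mf; exists a, pa.
  have mgf := measurableT_comp (@measurable_funPT _ _ _ _ g) mf.
  by exists (mfun_of mgf) => r; rewrite /= bE.
- move=> t; exists (qprob_plot (repr t)), (qprob_plotP (repr t)).
  have mc : measurable_fun setT
      (cst (qprob_meas (repr t)) : R -> pprobability R R).
    exact: measurable_cst.
  by exists (mfun_of mc) => r; rewrite /= qclass_repr.
- move=> S b c mS tS ST pb cE.
  have [idx SE] := partition_index tS ST.
  have midx i : measurable (idx @^-1` [set i]) by rewrite -SE.
  pose a i := projT1 (cid (pb i)).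
  pose pa i := projT1 (cid (projT2 (cid (pb i)))).
  pose g i := projT1 (cid (projT2 (cid (projT2 (cid (pb i)))))).
  have bE i r : b i r = qclass (pa i) (g i r).
    exact: (projT2 (cid (projT2 (cid (projT2 (cid (pb i))))))).
  pose code r : nat := Num.trunc `|d1 r|.
  have mcode i : measurable (code @^-1` [set i]).
    exact: measurable_truncn_norm.
  have codeK i s : code (e (i%:R, s)) = i.
    by rewrite /code d1K normr_nat natrK.
  have pA : plots X (fun r => a (code r) (d2 r)).
    apply: (qb_index (a := fun i r => a i (d2 r)) (plotsP X) mcode) => i.
    exact: (qb_comp (plotsP X) (pa i) md2).
  have mei i : measurable_fun setT (fun s => e (i%:R, s)).
    exact: measurableT_comp me (pair1_measurable _).
  (* Pushing [g i r] along [s |-> e (i, s)] moves it to the region where the merged plot acts as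
     [a i]. *)
  pose G r : pprobability R R :=
    distribution (g (idx r) r) (mfun_of (mei (idx r))).
  have mG : measurable_fun setT G.
    apply: measurable_to_pprobability => U mU.
    apply: (measurable_fun_index
      (f := fun i r => g i r ((fun s => e (i%:R, s)) @^-1` U)) midx) => i.
    apply: measurable_pprobability_ev.
    by rewrite -[X in measurable X]setTI; exact: (mei i measurableT U mU).
  exists _, pA, (mfun_of mG) => r.
  rewrite (cE (idx r)); last by rewrite SE.
  rewrite bE; apply/qclassP => U sU /=.
  rewrite /distribution /pushforward /=; congr (g _ _ _).
  by apply/seteqP; split=> s /=; rewrite codeK d2K.
Qed.

Definition qPobj X : qbs R := Qbs (quasi_borel_qP X).

End qP_theory.

(** * Bind, unit and the monad laws *)

Section qP_monad.
Variable R : realType.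
Implicit Types X Y Z : qbs R.

(** Specifies bind by its evaluations, a formula free of the chosen [b] and [g]; [qP_ev_inj] makes
    the class unique. *)
Lemma qP_bind_ex X Y (f : qhom X (qPobj Y)) (t : qP X) :
  exists s : qP Y, forall U, qbs_sigma Y U ->
    qP_ev s U = qP_int t (fun x => qP_ev (f x : qP Y) U).
Proof.
have [b [pb [g fE]]] := qhomP f (qprob_plotP (repr t)).
exists (qclass pb (prob_bind (qprob_meas (repr t)) g)) => U sU.
rewrite qP_evE//; apply: eq_integral => r _.
by rewrite [f _](fE r) qP_evE.
Qed.

Definition qP_bind X Y (f : qhom X (qPobj Y)) (t : qP X) : qP Y :=
  projT1 (cid (qP_bind_ex f t)).

Lemma qP_bindE X Y (f : qhom X (qPobj Y)) (a : R -> X) (pa : plots X a)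
    (mu : probability R R) (b : R -> Y) (pb : plots Y b)
    (g : {mfun R >-> pprobability R R}) :
  (forall r, f (a r) = qclass pb (g r)) ->
  qP_bind f (qclass pa mu) = qclass pb (prob_bind mu g).
Proof.
move=> fE; apply: qP_ev_inj => U sU.
rewrite /qP_bind; case: cid => s /= ->//; rewrite qP_intE.
- by rewrite qP_evE//; apply: eq_integral => r _; rewrite fE qP_evE.
- by move=> x; exact: qP_ev_ge0.
- by move=> c pc; apply: (measurable_qP_ev (b := f \o c)) => //; exact: (qhomP f pc).
Qed.

(** Joint form giving both that each bind is a morphism (constant [c]) and that bind itself is
    one. *)
Lemma qP_plots_bind X Y (c : R -> qhom X (qPobj Y)) (u : R -> R)
    (v : R -> qP X) :
  plots (qexp X (qPobj Y)) c -> measurable_fun setT u -> qP_plots X v ->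
  qP_plots Y (fun r => qP_bind (c (u r)) (v r)).
Proof.
move=> pc mu [a [pa [g vE]]].
have [e [d1 [d2 [me md1 md2 d1K d2K]]]] := real_pairing R.
(* A plot of classes needs one underlying plot for all [r]: decoding the pair yields a single [b]
   and [k] serving all [(r, s)]. *)
have [] := pc (fun p => (u (d1 p), a (d2 p))).
  split; first exact: measurableT_comp mu md1.
  exact: (qb_comp (plotsP X) pa md2).
move=> b [pb [k kE]].
have mk r : measurable_fun setT (fun s => k (e (r, s))).
  apply: (measurableT_comp (@measurable_funPT _ _ _ _ k)).
  exact: measurableT_comp me (pair1_measurable _).
pose G r : pprobability R R := prob_bind (g r) (mfun_of (mk r)).
have mG : measurable_fun setT G.
  apply: measurable_to_pprobability => U mU.
  apply: (measurable_fun_integral_sfinite_kernel (fun p => k (e p) U)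
    (kprobability (@measurable_funPT _ _ _ _ g))) => //.
  exact: measurableT_comp (measurable_pprobability_ev _ mU) me.
exists b, pb, (mfun_of mG) => r.
rewrite vE; apply: qP_bindE => s /=.
by have := kE (e (r, s)); rewrite /= d1K d2K.
Qed.

Lemma qP_bind_morphism X Y (f : qhom X (qPobj Y)) :
  @is_morphism R (qPobj X) (qPobj Y) (qP_bind f).
Proof.
move=> v pv; apply: (@qP_plots_bind _ _ (fun=> f) id) => //.
exact: (qb_cst (plotsP (qexp X (qPobj Y)))).
Qed.

Definition qP_bindh X Y (f : qhom X (qPobj Y)) : qhom (qPobj X) (qPobj Y) :=
  Qhom (@qP_bind_morphism X Y f).

Lemma qP_bindh_morphism X Y :
  @is_morphism R (qexp X (qPobj Y)) (qexp (qPobj X) (qPobj Y)) (@qP_bindh X Y).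
Proof. by move=> c pc w [mu pv]; exact: (qP_plots_bind pc mu pv). Qed.

Definition qP_eta_fun X (x : X) : qP X :=
  qclass (qb_cst (plotsP X) x) (dirac (0 : R)).

(** A preimage under a constant map is empty or everything, where all probability measures agree. *)
Lemma qP_etaE X (x : X) (mu : probability R R) :
  qP_eta_fun x = qclass (qb_cst (plotsP X) x) mu.
Proof.
apply/qclassP => U _; have [xU|xU] := pselect (U x).
- by rewrite preimage_cst mem_set// !probability_setT.
- by rewrite preimage_cst memNset// !measure0.
Qed.

Lemma measurable_dirac :
  measurable_fun setT (fun r : R => dirac r : pprobability R R).
Proof.
by apply: measurable_to_pprobability => U; exact: measurable_fun_dirac.
Qed.

(** Choosing the Dirac measure at [r] lets [a] itself be the common plot. *)
Lemma qP_eta_plot X (a : R -> X) (pa : plots X a) r :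
  qP_eta_fun (a r) = qclass pa (mfun_of measurable_dirac r).
Proof. by rewrite (qP_etaE _ (dirac r)); apply/qclassP. Qed.

Lemma qP_eta_morphism X : @is_morphism R X (qPobj X) (@qP_eta_fun X).
Proof.
move=> a pa; exists a, pa, (mfun_of measurable_dirac) => r.
exact: qP_eta_plot.
Qed.

Definition qP_eta X : qhom X (qPobj X) := Qhom (@qP_eta_morphism X).

Lemma qP_strong_monad :
  is_strong_monad qP_eta (fun X Y => Qhom (@qP_bindh_morphism X Y)).
Proof.
split.
(* Right unit: the Dirac kernel evaluates to an indicator, whose integral is the measure. *)
- move=> X t; rewrite -[t in RHS]qclass_repr -[t in LHS]qclass_repr.
  rewrite /qapp /= (qP_bindE (f := qP_eta X) _ _
    (qP_eta_plot (qprob_plotP (repr t)))).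
  apply/qclassP => U sU; rewrite /= /prob_bind.
  have mU := sU _ (qprob_plotP (repr t)).
  by rewrite -[in RHS](setIT (_ @^-1` _)) -[RHS]integral_indic.
(* Left unit: along a constant plot [f] is given by a constant kernel. *)
- move=> X Y x f; rewrite /qapp /= /qP_eta_fun.
  have mc : measurable_fun setT
      (cst (qprob_meas (repr (f x : qP Y))) : R -> pprobability R R).
    exact: measurable_cst.
  have fE r : f (cst x r) =
      qclass (qprob_plotP (repr (f x : qP Y))) (mfun_of mc r).
    by rewrite /= qclass_repr.
  rewrite (qP_bindE _ _ fE) -[RHS](qclass_repr (f x)).
  apply/qclassP => U sU /=.
  by rewrite /prob_bind integral_cst//= probability_setT mule1.
(* Associativity: both sides become classes over the same plot [c], and their measures agree by
   [integral_prob_bind]. *)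
- move=> X Y Z t f g; rewrite /qapp /=.
  have [b [pb [k fE]]] := qhomP f (qprob_plotP (repr t)).
  have [c [pc [h gE]]] := qhomP g pb.
  have mk : measurable_fun setT
      (fun r => prob_bind (k r) h : pprobability R R).
    apply: measurable_to_pprobability => U mU.
    apply: (measurable_fun_integral_kernel
      (l := kprobability (@measurable_funPT _ _ _ _ k))) => //.
    - by move=> V mV; exact: measurable_pprobability_ev.
    - exact: measurable_pprobability_ev.
  have gfE r : qcomp (qP_bindh g) f (qprob_plot (repr t) r) =
      qclass pc (mfun_of mk r).
    by rewrite /= [f _](fE r); exact: qP_bindE.
  rewrite -[t]qclass_repr (qP_bindE _ _ gfE) (qP_bindE _ _ fE).
  rewrite (qP_bindE _ _ gE); apply/qclassP => U sU /=.
  rewrite [RHS]integral_prob_bind//.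
  by apply: measurable_pprobability_ev; exact: sU.
Qed.

End qP_monad.

Theorem theorem21 (R : realType) :
  exists PQ : forall X : qbs R, quasi_borel (qP_plots X),
  let P := fun X : qbs R => Qbs (PQ X) in
  exists (eta : forall X : qbs R, qhom X (P X))
         (bind : forall X Y : qbs R, qhom (qexp X (P Y)) (qexp (P X) (P Y))),
  [/\ forall (X : qbs R) (x : X) (mu : probability R R),
        eta X x = qclass (qb_cst (plotsP X) x) mu,
      forall (X Y : qbs R) (f : qhom X (P Y))
             (a : R -> X) (pa : plots X a) (mu : probability R R)
             (b : R -> Y) (pb : plots Y b) (g : {mfun R >-> pprobability R R}),
        (forall r, f (a r) = qclass pb (g r)) ->
        qapp (bind X Y f) (qclass pa mu) = qclass pb (prob_bind mu g)
    & is_strong_monad eta bind].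
Proof.
exists (@quasi_borel_qP R), (@qP_eta R).
exists (fun X Y => Qhom (@qP_bindh_morphism R X Y)).
split; [exact: qP_etaE | exact: qP_bindE | exact: qP_strong_monad].
Qed.
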